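(* Let $A$ be a ring, let $G$ be a group, let $S$ be a submonoid of $G$ with $G=S^{-1}S$, and let $\alpha:S\to \mathrm{Endr}(A)$, $s\mapsto\alpha_s$, be an action of $S$ on $A$ by corner isomorphisms; write $p_s=\alpha_s(1)$. Suppose that $A$ is either a purely infinite simple ring or a simple ultramatricial algebra over some field. Assume also that $\alpha$ is outer, and that there exists $u\in S$ with $p_u\ne 1$. Then $R=S^{\mathrm{op}}*_\alpha A*_\alpha S$ is a purely infinite simple ring.
   Context: All rings are unital. $\mathrm{Endr}(A)$ is the monoid (under composition) of not necessarily unital ring endomorphisms of $A$. $G=S^{-1}S$ means every element of $G$ has the form $s^{-1}t$ with $s,t\in S$. An action $\alpha$ of $S$ on $A$ by corner isomorphisms is a monoid homomorphism $\alpha:S\to\mathrm{Endr}(A)$ such that for each $s\in S$, with $p_s:=\alpha_s(1)$ (an idempotent), $\alpha_s$ is an isomorphism of $A$ onto the corner ring $p_sAp_s$ (in particular $\alpha_s$ is injective). The ring $R=S^{\mathrm{op}}*_\alpha A*_\alpha S$ is the unital ring equipped with a unital ring homomorphism $\phi:A\to R$ and monoid homomorphisms $s\mapsto s_-$ from $S^{\mathrm{op}}$ to $R$ (so $(su)_-=u_-s_-$, $1_-=1$) and $t\mapsto t_+$ from $S$ to $R$ (to the multiplicative monoid of $R$), universal with respect to the relations: (1) $t_+\phi(a)=\phi(\alpha_t(a))t_+$ for $a\in A$, $t\in S$; (2) $\phi(a)s_-=s_-\phi(\alpha_s(a))$ for $a\in A$, $s\in S$; (3) $s_-s_+=1$ for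 $s\in S$; (4) $s_+s_-=\phi(p_s)$ for $s\in S$. A pair $(\alpha_s,\alpha_t)$ with $s,t\in S$ is inner if there exist $u\in p_sAp_t$ and $v\in p_tAp_s$ such that $uv=p_s$, $vu=p_t$ and $\alpha_s(x)=u\alpha_t(x)v$ for all $x\in A$. The action $\alpha$ is outer if $(\alpha_s,\alpha_t)$ is not inner for any distinct $s,t\in S$. A simple ring $T$ is purely infinite if every nonzero right ideal of $T$ contains an infinite idempotent, i.e. an idempotent $e$ such that $eT$ is isomorphic to a proper direct summand of itself. (Known equivalent characterization: $T$ is not a division ring, and for every nonzero $a\in T$ there exist $x,y\in T$ with $xay=1$.) An algebra over a field $k$ is ultramatricial if it is the union of an ascending sequence of unital subalgebras each of which is isomorphic to a finite direct product of full matrix algebras $M_{n}(k)$. *)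

(* Defs.v *)
From HB Require Import structures.
From mathcomp Require Import all_boot all_order all_algebra.
From mathcomp Require Import boolp classical_sets functions cardinality.

Set Implicit Arguments.
Unset Strict Implicit.
Unset Printing Implicit Defensive.

Import GRing.Theory.

Local Open Scope classical_set_scope.
Local Open Scope ring_scope.

(* Rings are unital and possibly zero (pzRingType); a simple ring is nonzero
   by definition. *)

Section PurelyInfiniteSimple.
Variable T : pzRingType.

Definition right_ideal (J : set T) : Prop :=
  [/\ J 0, forall x y, J x -> J y -> J (x + y)
    & forall x a, J x -> J (x * a)].

Definition two_sided_ideal (J : set T) : Prop :=
  right_ideal J /\ forall a x, J x -> J (a * x).

Definition simple_ring : Prop :=
  (1 : T) <> 0 /\
  forall J, two_sided_ideal J -> J = [set 0] \/ J = [set: T].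

Definition principal_right_ideal (e : T) : set T := [set e * x | x in [set: T]].

(* The submodules of the right T-module T are the right ideals, so submodules
   of eT, their direct sums and the T-linear maps between them are expressed
   inside T.  A map M -> N is given by a function on T, of which only the
   values on M matter. *)
Definition right_module_iso (M N : set T) : Prop :=
  exists f : T -> T,
    [/\ forall x y, M x -> M y -> f (x + y) = f x + f y,
        forall x a, M x -> f (x * a) = f x * a
      & set_bij M N f].

Definition direct_summand (M N : set T) : Prop :=
  exists N' : set T,
    [/\ right_ideal N, right_ideal N', N `&` N' = [set 0]
      & M = [set x + y | x in N & y in N']].

Definition infinite_idempotent (e : T) : Prop :=
  e * e = e /\
  exists N : set T,
    [/\ direct_summand (principal_right_ideal e) N,
        N <> principal_right_ideal e
      & right_module_iso (principal_right_ideal e) N].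

Definition purely_infinite_simple : Prop :=
  simple_ring /\
  forall J, right_ideal J -> J <> [set 0] ->
    exists2 e, J e & infinite_idempotent e.

End PurelyInfiniteSimple.

Section Ultramatricial.
Variables (k : fieldType) (B : algType k).

Definition unital_subalgebra (C : set B) : Prop :=
  [/\ C 1, forall (a : k) x y, C x -> C y -> C (a *: x + y)
    & forall x y, C x -> C y -> C (x * y)].

(* C is isomorphic, as a unital k-algebra, to the product of the full matrix
   algebras M_(d i + 1)(k), i < m; the operations of the product are written
   componentwise. *)
Definition finite_product_of_matrix_algebras (C : set B) : Prop :=
  exists (m : nat) (d : 'I_m -> nat)
         (f : B -> {dffun forall i : 'I_m, 'M[k]_((d i).+1)}),
    [/\ forall i, f 1 i = 1,
        forall (a : k) x y i, C x -> C y -> f (a *: x + y) i = a *: f x i + f y i,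
        forall x y i, C x -> C y -> f (x * y) i = f x i * f y i
      & set_bij C [set: {dffun forall i : 'I_m, 'M[k]_((d i).+1)}] f].

Definition ultramatricial : Prop :=
  exists F : nat -> set B,
    [/\ forall n, unital_subalgebra (F n),
        forall n, F n `<=` F n.+1,
        \bigcup_n F n = [set: B]
      & forall n, finite_product_of_matrix_algebras (F n)].

End Ultramatricial.

(* The ring A carries the structure of an ultramatricial algebra over some
   field, the structure being transported along a ring isomorphism. *)
Definition ultramatricial_over_some_field (A : pzRingType) : Prop :=
  exists (k : fieldType) (B : algType k) (f : {rmorphism B -> A}),
    bijective f /\ ultramatricial B.

Section CornerActions.
Variables (S : monoidType) (A : pzRingType).

Definition corner (e f : A) : set A := [set e * a * f | a in [set: A]].

Record corner_action (alpha : S -> A -> A) : Prop := CornerAction {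
  corner_actionD : forall s, {morph alpha s : x y / x + y};
  corner_actionM : forall s, {morph alpha s : x y / x * y};
  corner_action_one : forall x, alpha 1%g x = x;
  corner_action_mul : forall s t x, alpha (s * t)%g x = alpha s (alpha t x);
  corner_action_bij :
    forall s, set_bij [set: A] (corner (alpha s 1) (alpha s 1)) (alpha s)
}.

Definition inner_pair (alpha : S -> A -> A) (s t : S) : Prop :=
  exists u v : A,
    [/\ corner (alpha s 1) (alpha t 1) u, corner (alpha t 1) (alpha s 1) v,
        u * v = alpha s 1, v * u = alpha t 1
      & forall x, alpha s x = u * alpha t x * v].

Definition outer_action (alpha : S -> A -> A) : Prop :=
  forall s t : S, s <> t -> ~ inner_pair alpha s t.

(* [sm s] and [sp s] stand for s_- and s_+. *)
Record corner_skew_relations (alpha : S -> A -> A) (T : pzRingType)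
    (phi : A -> T) (sm sp : S -> T) : Prop := CornerSkewRelations {
  corner_skew_minus1 : sm 1%g = 1;
  corner_skew_minusM : forall s u, sm (s * u)%g = sm u * sm s;
  corner_skew_plus1 : sp 1%g = 1;
  corner_skew_plusM : forall s u, sp (s * u)%g = sp s * sp u;
  corner_skew_plus_comm : forall t a, sp t * phi a = phi (alpha t a) * sp t;
  corner_skew_minus_comm : forall s a, phi a * sm s = sm s * phi (alpha s a);
  corner_skew_minus_plus : forall s, sm s * sp s = 1;
  corner_skew_plus_minus : forall s, sp s * sm s = phi (alpha s 1)
}.

(* R, with phi, sm and sp, is S^op *_alpha A *_alpha S. *)
Definition corner_skew_monoid_ring (alpha : S -> A -> A) (R : pzRingType)
    (phi : {rmorphism A -> R}) (sm sp : S -> R) : Prop :=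
  corner_skew_relations alpha phi sm sp /\
  forall (T : pzRingType) (phi' : {rmorphism A -> T}) (sm' sp' : S -> T),
    corner_skew_relations alpha phi' sm' sp' ->
    let compatible (h : R -> T) :=
      [/\ h \o phi =1 phi', h \o sm =1 sm' & h \o sp =1 sp'] in
    exists2 h : {rmorphism R -> T}, compatible h
      & forall h' : {rmorphism R -> T}, compatible h' -> h' =1 h.

End CornerActions.

(* Main.v *)
From HB Require Import structures.
Require Import Defs.
From mathcomp Require Import all_boot all_order all_algebra.
From mathcomp Require Import boolp classical_sets functions cardinality.
From mathcomp Require Import zify.

(** An element of R can be written s_- (a_1 t_1+ + ... + a_n t_n+).  Given two
    terms with t_1 <> t_2, outerness provides x, y in A such that
    x a_1 alpha_{t_1}(y) <> 0 and x a_2 alpha_{t_2}(y) = 0, so that multiplying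
    by x and y on both sides shortens the sum; every nonzero element of R is
    thus brought down to a monomial a t_+ with a <> 0.  For such an a there are
    x, y in A and s in S with x a y = p_s: one can take s = 1 if A is purely
    infinite; if A is ultramatricial, p_{u^m} has arbitrarily small rank
      compared
    to 1, hence factors through a when m is large.  Since s_- p_s s_+ = 1, every
    nonzero r in R satisfies X r Y = 1 for some X, Y, and 1 is an infinite
    idempotent of R because u_- u_+ = 1 and u_+ u_- = p_u <> 1.

    For the two-term step, x a y = p_s also lets one assume a_2 = alpha_{t_2}(f)
    with f idempotent.  If no x, y existed, testing on x = 1 - alpha_{t_2}(e),
    y = e for idempotents e <= f would give
    alpha_{t_2}(e) a_1 = a_1 alpha_{t_1}(e).  Idempotents generate f A f, and
    A f A = A, so this extends to an element intertwining alpha_{t_1} and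
    alpha_{t_2}; over the simple ring A such an element makes the pair inner. *)

Set Implicit Arguments.
Unset Strict Implicit.
Unset Printing Implicit Defensive.

Import GRing.Theory.

Local Open Scope ring_scope.

(** * Simple rings and the ideal generated by an element *)

Section SimpleRing.
Variable A : pzRingType.

(** After [!mulrA] every product is nested to the left; these two forms let a relation be applied
    behind an arbitrary prefix [z]. *)
Lemma mulr2E (a b c : A) : a * b = c -> forall z, z * a * b = z * c.
Proof. by move=> <- z; rewrite mulrA. Qed.

Lemma mulr3E (a b d c : A) : a * b * d = c -> forall z, z * a * b * d = z * c.
Proof. by move=> <- z; rewrite !mulrA. Qed.

Definition generates_one (a : A) : Prop :=
  exists l : seq (A * A), \sum_(c <- l) c.1 * a * c.2 = 1.

(** The values of such sums form a two-sided ideal containing [a]. *)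
Lemma simple_generates_one : simple_ring A ->
  forall a : A, a <> 0 -> generates_one a.
Proof.
move=> [_ hid] a ha.
pose J : set A :=
  fun x => exists l : seq (A * A), \sum_(c <- l) c.1 * a * c.2 = x.
have [J0|JT] : J = [set 0]%classic \/ J = [set: A]%classic; first last.
- by have : J 1 by rewrite JT.
- have : J a by exists [:: (1, 1)]; rewrite big_seq1 mul1r mulr1.
  by rewrite J0 => /ha.
apply: hid; split; [split|].
- by exists [::]; rewrite big_nil.
- by move=> _ _ [l <-] [l' <-]; exists (l ++ l'); rewrite big_cat.
- move=> _ b [l <-]; exists [seq (c.1, c.2 * b) | c <- l].
  by rewrite big_map mulr_suml; apply: eq_bigr => c _; rewrite !mulrA.
- move=> b _ [l <-]; exists [seq (b * c.1, c.2) | c <- l].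
  by rewrite big_map mulr_sumr; apply: eq_bigr => c _; rewrite !mulrA.
Qed.

(** If f A a = 0, then expanding 1 as a sum of terms x f y in 1 a gives a = 0. *)
Lemma generates_one_prime (f a : A) :
  generates_one f -> a <> 0 -> exists z, f * z * a <> 0.
Proof.
move=> [l hl] ha; apply: contrapT => h; apply: ha.
rewrite -[a]mul1r -hl mulr_suml big1 // => c _.
rewrite -!mulrA (mulrA f); have -> : f * c.2 * a = 0 by apply: contrapT => h';
  apply: h; exists c.2.
by rewrite mulr0.
Qed.

End SimpleRing.

(** * Corner actions: intertwiners and separation by outerness *)

Section CornerAction.
Variables (S : monoidType) (A : pzRingType) (alpha : S -> A -> A).
Hypothesis halpha : corner_action alpha.

Let p s := alpha s 1.

Lemma alphaD s x y : alpha s (x + y) = alpha s x + alpha s y.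
Proof. exact: corner_actionD. Qed.
Lemma alphaM s x y : alpha s (x * y) = alpha s x * alpha s y.
Proof. exact: corner_actionM. Qed.
Lemma alpha0 s : alpha s 0 = 0.
Proof. by apply: (addrI (alpha s 0)); rewrite -alphaD !addr0. Qed.
Lemma alphaN s x : alpha s (- x) = - alpha s x.
Proof. by apply: (addrI (alpha s x)); rewrite -alphaD !subrr alpha0. Qed.
Lemma alphaB s x y : alpha s (x - y) = alpha s x - alpha s y.
Proof. by rewrite alphaD alphaN. Qed.
Lemma alpha_sum s I (l : seq I) (F : I -> A) :
  alpha s (\sum_(i <- l) F i) = \sum_(i <- l) alpha s (F i).
Proof. exact: (big_morph _ (alphaD s) (alpha0 s)). Qed.
Lemma alpha_inj s : injective (alpha s).
Proof.
by have [_ inj _] := corner_action_bij halpha s => x y; apply: inj; rewrite inE.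
Qed.
Lemma alpha1M s x : p s * alpha s x = alpha s x.
Proof. by rewrite -alphaM mul1r. Qed.
Lemma alphaM1 s x : alpha s x * p s = alpha s x.
Proof. by rewrite -alphaM mulr1. Qed.
Lemma alpha_surj s x : exists y, alpha s y = p s * x * p s.
Proof.
have [_ _ surj] := corner_action_bij halpha s.
have : corner (p s) (p s) (p s * x * p s) by exists x.
by move=> /surj [y _ <-]; exists y.
Qed.

(** Cut a relation 1 = sum x c y by p_s on both sides: p_s y p_s is some alpha_s(r), so c moves to
    the right end, which gives a left inverse of c. Cutting by p_t moves c to the left end and gives
    a right inverse. The two one-sided inverses agree. *)
Lemma intertwiner_inner s t c : simple_ring A -> c <> 0 ->
    p t * c = c -> c * p s = c ->
    (forall y, alpha t y * c = c * alpha s y) ->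
  inner_pair alpha s t.
Proof.
move=> hA c0 tc cs hc; have [l hl] := simple_generates_one hA c0.
have [u hu] : exists u, p s * (\sum_(i <- l) i.1 * c * i.2) * p s = u * c.
  elim: l {hl} => [|i l [u IH]].
    by exists 0; rewrite big_nil mulr0 !mul0r.
  have [r hr] := alpha_surj s i.2.
  exists (p s * i.1 * alpha t r + u).
  rewrite big_cons mulrDr mulrDl IH mulrDl -[in RHS]mulrA hc hr !mulrA.
  by rewrite -[_ * c * p s]mulrA cs.
have [v hv] : exists v, p t * (\sum_(i <- l) i.1 * c * i.2) * p t = c * v.
  elim: l {hl hu} => [|i l [v IH]].
    by exists 0; rewrite big_nil mulr0 !mul0r mulr0.
  have [r hr] := alpha_surj t i.1.
  exists (alpha s r * i.2 * p t + v).
  rewrite big_cons mulrDr mulrDl IH mulrDr !mulrA -hc hr.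
  by rewrite -[_ * p t * c]mulrA tc.
rewrite hl mulr1 -alphaM mulr1 in hu; rewrite hl mulr1 -alphaM mulr1 in hv.
have huc : p s * u * p t * c = p s.
  by rewrite -!mulrA tc -hu -/(p s) alpha1M.
have hcv : c * (p s * v * p t) = p t.
  by rewrite !mulrA cs -hv -/(p t) alphaM1.
have uv : p s * u * p t = p s * v * p t.
  by rewrite -[LHS](mulr2E (alphaM1 t 1)) -/(p t) -{2}hcv mulrA huc !mulrA
    alpha1M.
exists (p s * u * p t), c; split => //.
- by exists u.
- by exists c => //; rewrite tc cs.
- by rewrite uv.
- by move=> x; rewrite -mulrA hc !mulrA huc alpha1M.
Qed.

(** This is the form in which both alternatives for [A] enter the argument. *)
Definition compresses_to_corner : Prop :=
  forall a, a <> 0 -> exists x y s, x * a * y = alpha s 1.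

Hypothesis hsimple : simple_ring A.
Hypothesis hcorner : compresses_to_corner.
Hypothesis hproper : exists u, p u <> 1.

Lemma corner_nonzero s : p s <> 0.
Proof. by rewrite -(alpha0 s) => /alpha_inj; case: hsimple. Qed.

(** If x f y = p_s, then f y q x f is a copy below f of the idempotent q = alpha_s(p_u). Compressing
    it by x and y returns q, and q is neither 0 nor p_s by injectivity of alpha_s. *)
Lemma nontrivial_subidempotent (f : A) : f * f = f -> f <> 0 ->
  exists e, [/\ e * e = e, f * e = e, e * f = e, e <> 0 & e <> f].
Proof.
move=> ff f0; have [x [y [s xfy]]] := hcorner f0.
have [u hu] := hproper.
pose q := alpha s (p u).
have qq : q * q = q by rewrite -alphaM -alphaM mulr1.
have pq : p s * q = q by rewrite alpha1M.
have qp : q * p s = q by rewrite alphaM1.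
exists (f * y * q * x * f).
have xey : x * (f * y * q * x * f) * y = q.
  by rewrite !mulrA xfy (mulr3E xfy) pq qp.
split.
- by rewrite !mulrA (mulr2E ff) (mulr3E xfy) (mulr2E qp) (mulr2E qq).
- by rewrite !mulrA ff.
- by rewrite (mulr2E ff).
- by move=> e0; move: xey; rewrite e0 mulr0 mul0r -(alpha0 s) => /alpha_inj
    /esym/corner_nonzero.
- by move=> ef; move: xey; rewrite ef xfy => /alpha_inj/esym.
Qed.

(* By contradiction, Z y below says that a intertwines alpha t y and alpha s y;
   it holds for the idempotents of f' A f', hence for all of f' A f' by Zoff
   (e1 + e1 z e2 is idempotent) and Zdiag (e1 A e1 = e1 A e2 A e1). *)
Lemma separate_idempotent s t (a f' : A) : ~ inner_pair alpha s t ->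
  a * p s = a -> a <> 0 -> f' * f' = f' ->
  exists x y, x * a * alpha s y <> 0 /\ x * alpha t f' * alpha t y = 0.
Proof.
move=> houter ap a0 ff; apply: contrapT => hno.
have hno' x y : x * alpha t f' * alpha t y = 0 -> x * a * alpha s y = 0.
  by move=> h; apply: contrapT => h'; apply: hno; exists x, y.
(* The tests x = 1, y = 1 - f' and x = 1 - alpha_t(f'), y = f' show that a lies in alpha_t(f') A
   alpha_s(f'). *)
have af : a * alpha s f' = a.
  have := hno' 1 (1 - f'); rewrite !mul1r alphaB mulrBr alphaM1 -alphaM ff
    subrr.
  by rewrite alphaB mulrBr ap => /(_ erefl)/subr0_eq/esym.
have fa : alpha t f' * a = a.
  have := hno' (1 - alpha t f') f'; rewrite mulrBl mul1r -alphaM ff subrr mul0r.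
  by rewrite -mulrA af mulrBl mul1r => /(_ erefl)/subr0_eq/esym.
have f0 : f' <> 0 by move=> f0; apply: a0; rewrite -fa f0 alpha0 mul0r.
pose Z y := alpha t y * a = a * alpha s y.
have ZD y z : Z y -> Z z -> Z (y + z).
  by rewrite /Z => hy hz; rewrite !alphaD mulrDl mulrDr hy hz.
have ZN y : Z y -> Z (- y) by rewrite /Z !alphaN mulNr mulrN => ->.
have ZM y z : Z y -> Z z -> Z (y * z).
  by rewrite /Z => hy hz; rewrite !alphaM -mulrA hz mulrA hy mulrA.
have Zsum (l : seq (A * A)) (F : A * A -> A) :
    (forall i, Z (F i)) -> Z (\sum_(i <- l) F i).
  move=> hF; elim: l => [|i l IH]; last by rewrite big_cons; apply: ZD.
  by rewrite big_nil /Z !alpha0 mul0r mulr0.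
have Zidem e : e * e = e -> f' * e = e -> e * f' = e -> Z e.
  move=> ee fe ef; rewrite /Z.
  have h1 : (1 - alpha t e) * a * alpha s e = 0.
    by apply: hno'; rewrite -mulrA -alphaM fe mulrBl mul1r -alphaM ee subrr.
  have h2 : alpha t e * a * alpha s (f' - e) = 0.
    by apply: hno'; rewrite -!alphaM ef mulrBr ef ee subrr alpha0.
  move: h1; rewrite !mulrBl mul1r => /subr0_eq ->.
  by move: h2; rewrite alphaB mulrBr -[X in X - _]mulrA af => /subr0_eq.
have [e [ee fe ef e0 ef']] := nontrivial_subidempotent ff f0.
have Zoff e1 e2 z : e1 * e1 = e1 -> f' * e1 = e1 -> e1 * f' = e1 ->
    e2 * f' = e2 -> e2 * e1 = 0 -> Z (e1 * z * e2).
  move=> h1 h2 h3 h4 h5.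
  rewrite -[X in Z X](addKr e1); apply: ZD; first by apply/ZN/Zidem.
  apply: Zidem.
  - by rewrite mulrDl !mulrDr !mulrA h1 !(mulr2E h5) mulr0 !mul0r !addr0.
  - by rewrite mulrDr !mulrA h2.
  - by rewrite mulrDl h3 (mulr2E h4).
have Zdiag e1 e2 z : e1 * e1 = e1 -> f' * e1 = e1 -> e1 * f' = e1 ->
    e2 * e2 = e2 -> f' * e2 = e2 -> e2 * f' = e2 ->
    e1 * e2 = 0 -> e2 * e1 = 0 -> e2 <> 0 -> Z (e1 * z * e1).
  move=> h1 h2 h3 h4 h5 h6 h7 h8 /(simple_generates_one hsimple)[l hl].
  rewrite -[e1 * z]mulr1 -hl mulr_sumr mulr_suml; apply: Zsum => i.
  have -> : e1 * z * (i.1 * e2 * i.2) * e1 = (e1 * (z * i.1) * e2) * (e2 * i.2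
    * e1).
    by rewrite !mulrA (mulr2E h4).
  by apply: ZM; apply: Zoff.
pose g := f' - e.
have gg : g * g = g by rewrite mulrBl !mulrBr ff ef fe ee subrr subr0.
have fg : f' * g = g by rewrite mulrBr ff fe.
have gf : g * f' = g by rewrite mulrBl ff ef.
have eg : e * g = 0 by rewrite mulrBr ef ee subrr.
have ge : g * e = 0 by rewrite mulrBl fe ee subrr.
have g0 : g <> 0 by move=> /subr0_eq/esym/ef'.
have Zf z : Z (f' * z * f').
  (* Peirce decomposition of f' A f' along f' = g + e; both idempotents are nonzero, so each
     diagonal block is reached through the other one. *)
  have -> : f' * z * f' = (g * z * g + e * z * g) + (g * z * e + e * z * e).
    by rewrite -!mulrDl -mulrDr subrK.
  apply/ZD; apply/ZD; [exact: (Zdiag g e)|exact: Zoff|exact: Zoff|exact: (Zdiag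
    e g)].
have [l hl] := simple_generates_one hsimple f0.
(* Extension from f' A f' to A: with 1 = sum x_i f' y_i, c is what the intertwiner must be. By [wa],
   a is recovered from c on A f', and this yields both c <> 0 and the intertwining relation. *)
pose c := \sum_(i <- l) alpha t i.1 * a * alpha s i.2.
have wa w : alpha t w * a = c * alpha s (w * f').
  rewrite -{1}fa mulrA -alphaM -{1}[w]mul1r -hl !mulr_suml alpha_sum mulr_suml.
  apply: eq_bigr => i _.
  have -> : i.1 * f' * i.2 * w * f' = i.1 * (f' * (i.2 * w) * f').
    by rewrite !mulrA.
  by rewrite alphaM -mulrA Zf !alphaM !mulrA (mulr2E af).
apply: houter; apply: (intertwiner_inner (c := c)) => //.
- move=> c0; apply: a0; rewrite -fa -[f' in LHS]mul1r alphaM -mulrA fa.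
  by rewrite -/(p t) wa c0 mul0r.
- by rewrite mulr_sumr; apply: eq_bigr => i _; rewrite !mulrA alpha1M.
- by rewrite mulr_suml; apply: eq_bigr => i _; rewrite -mulrA alphaM1.
- move=> y; rewrite -[y in RHS]mulr1 -hl !mulr_sumr alpha_sum mulr_sumr.
  apply: eq_bigr => i _.
  by rewrite !mulrA -alphaM wa -!mulrA -alphaM !mulrA.
Qed.

(** Reduction to an idempotent: x b y = p_r provides c such that c b is an idempotent of p_t A p_t,
    hence of the form alpha_t(f'). The pair found for c a and c b then serves a and b after
    absorbing c into x. *)
Lemma separate s t (a b : A) : ~ inner_pair alpha s t ->
  a * p s = a -> a <> 0 -> b * p t = b ->
  exists x y, x * a * alpha s y <> 0 /\ x * b * alpha t y = 0.
Proof.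
move=> houter ap a0 bp.
have [b0|b0] := pselect (b = 0).
  by exists 1, 1; rewrite b0 mulr0 !mul0r mul1r ap.
have sep c : p t * c = c -> c * b * (c * b) = c * b -> c * a <> 0 ->
    exists x y, x * a * alpha s y <> 0 /\ x * b * alpha t y = 0.
  move=> pc cbcb ca0.
  have [f' hf] := alpha_surj t (c * b); rewrite !mulrA pc -mulrA bp in hf.
  have ff : f' * f' = f' by apply: (@alpha_inj t); rewrite alphaM hf.
  have cap : c * a * p s = c * a by rewrite -mulrA ap.
  have [x [y [h1 h2]]] := separate_idempotent houter cap ca0 ff.
  by exists (x * c), y; move: h1 h2; rewrite hf !mulrA.
have [x [y [r xby]]] := hcorner b0.
pose c := p t * y * p r * x; pose f := c * b.
have rr : p r * p r = p r by rewrite alphaM1.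
have pc : p t * c = c by rewrite !mulrA -alphaM mulr1.
have ff : f * f = f.
  by rewrite /f /c !mulrA (mulr2E bp) (mulr3E xby) (mulr2E rr) (mulr2E rr).
have f0 : f <> 0.
  move=> f0; have : x * b * f * y = p r.
    by rewrite /f /c !mulrA (mulr2E bp) xby rr (mulr3E xby) rr.
  by rewrite f0 mulr0 mul0r => /esym/corner_nonzero.
have [ca0|ca0] := pselect (c * a = 0); last exact: (sep c).
have [z hz] := generates_one_prime (simple_generates_one hsimple f0) a0.
have pf : p t * f = f by rewrite mulrA pc.
(* Here c a = 0. The corrected multiplier sends a to f z a, which is nonzero, and sends b to f + g
   with f g = g and g f = 0, which is still idempotent. *)
apply: (sep (c + f * z * (1 - b * c))).
- by rewrite mulrDr pc (mulrA (p t)) (mulrA (p t)) pf.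
- have -> : (c + f * z * (1 - b * c)) * b = f + f * z * (b - b * f).
    by rewrite mulrDl -(mulrA (f * z)) mulrBl mul1r -(mulrA b c b).
  set g := f * z * (b - b * f).
  have fg : f * g = g by rewrite /g (mulrA f) (mulrA f) ff.
  have gf : g * f = 0 by rewrite -(mulrA _ _ f) mulrBl -(mulrA b f f) ff subrr
    mulr0.
  have gg : g * g = 0 by rewrite -{2}fg (mulrA g) gf mul0r.
  by rewrite mulrDl !mulrDr ff fg gf gg !addr0.
- by rewrite mulrDl ca0 add0r -(mulrA (f * z)) mulrBl mul1r -(mulrA b c a) ca0
    mulr0 subr0.
Qed.

End CornerAction.

(** * Induction on the generators of the universal ring *)

Section SubringInduction.
Variables (R : pzRingType) (D : R -> Prop).
Hypothesis hD : subring_closed (fun x => `[< D x >]).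

(** The closure proof is an argument of the type, so that the ring structure can be attached to it
    as a canonical instance. *)
Definition subring_of of subring_closed (fun x => `[< D x >]) : Type :=
  {x : R | `[< D x >]}.

Local Notation U := (subring_of hD).

HB.instance Definition _ := SubChoice.on U.
HB.instance Definition _ :=
  GRing.SubChoice_isSubPzRing.Build R (fun x => `[< D x >]) U hD.

End SubringInduction.

(** The elements satisfying [D] form a subring containing the generators, so universality maps R
    into it. Followed by the inclusion, this map fixes the generators, hence is the identity by
    uniqueness. *)
Lemma corner_skew_monoid_ring_ind (S : monoidType) (A R : pzRingType)
    (alpha : S -> A -> A) (phi : {rmorphism A -> R}) (sm sp : S -> R)
    (D : R -> Prop) :
  corner_skew_monoid_ring alpha phi sm sp ->
  D 1 -> (forall x y, D x -> D y -> D (x - y)) ->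
  (forall x y, D x -> D y -> D (x * y)) ->
  (forall a, D (phi a)) -> (forall s, D (sm s)) -> (forall s, D (sp s)) ->
  forall x, D x.
Proof.
move=> [hrel huniv] D1 DB DM Dphi Dsm Dsp.
have hD : subring_closed (fun x => `[< D x >]).
  by split=> [|x y /asboolP hx /asboolP hy|x y /asboolP hx /asboolP hy];
    apply/asboolP; auto.
pose U : pzRingType := subring_of hD.
pose inU x (Dx : D x) : U := exist _ x (asboolT Dx).
pose phi' a : U := inU _ (Dphi a).
have phi'_zmod : zmod_morphism phi' by move=> a b; apply: val_inj; rewrite /=
  rmorphB.
have phi'_monoid : monoid_morphism phi'.
  by split=> [|a b]; apply: val_inj; rewrite /= ?rmorph1 ?rmorphM.
pose phiU : {rmorphism A -> U} := HB.pack phi'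
  (GRing.isZmodMorphism.Build _ _ phi' phi'_zmod)
  (GRing.isMonoidMorphism.Build _ _ phi' phi'_monoid).
have relU : corner_skew_relations alpha phiU (fun s => inU _ (Dsm s))
    (fun s => inU _ (Dsp s)).
  by case: hrel => *; split=> *; apply: val_inj => /=; auto.
have [h [h1 h2 h3] _] := huniv U phiU _ _ relU.
have [k _ kuniq] := huniv R phi _ _ hrel.
have e1 := kuniq idfun.
have e2 := kuniq (val \o h : {rmorphism R -> R}).
move=> x.
have <- : val (h x) = x.
  rewrite -[RHS]/(idfun x) e1 //.
  apply: e2; split=> a /=.
  - by rewrite -[h _]/((h \o phi) a) h1.
  - by rewrite -[h _]/((h \o sm) a) h2.
  - by rewrite -[h _]/((h \o sp) a) h3.
by apply/asboolP; exact: (valP (h x : U)).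
Qed.

(** * Normal forms in R and reduction to monomials *)

Section CornerSkewMonoidRing.
Variables (S : monoidType) (A R : pzRingType) (alpha : S -> A -> A).
Variables (phi : {rmorphism A -> R}) (sm sp : S -> R).
Hypothesis halpha : corner_action alpha.
Hypothesis hR : corner_skew_monoid_ring alpha phi sm sp.
Hypothesis ore : forall s t : S, exists u v, (u * s = v * t)%g.

Let p s := alpha s 1.

Let sm1 : sm 1%g = 1. Proof. by case: hR => -[]. Qed.
Let sp1 : sp 1%g = 1. Proof. by case: hR => -[]. Qed.
Let smM s u : sm (s * u)%g = sm u * sm s. Proof. by case: hR => -[]. Qed.
Let spM s u : sp (s * u)%g = sp s * sp u. Proof. by case: hR => -[]. Qed.
Let sp_phi t a : sp t * phi a = phi (alpha t a) * sp t.
Proof. by case: hR => -[]. Qed.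
Let phi_sm s a : phi a * sm s = sm s * phi (alpha s a).
Proof. by case: hR => -[]. Qed.
Let sm_sp s : sm s * sp s = 1. Proof. by case: hR => -[]. Qed.
Let sp_sm s : sp s * sm s = phi (p s). Proof. by case: hR => -[]. Qed.

Lemma phi_corner_sp s : phi (p s) * sp s = sp s.
Proof. by rewrite -sp_sm -mulrA sm_sp mulr1. Qed.

Definition positive_sum (l : seq (A * S)) : R :=
  \sum_(c <- l) phi c.1 * sp c.2.

Lemma mul_phi_positive_sum a l :
  phi a * positive_sum l = positive_sum [seq (a * c.1, c.2) | c <- l].
Proof.
by rewrite /positive_sum big_map mulr_sumr; apply: eq_bigr => c _; rewrite
  rmorphM mulrA.
Qed.

Lemma mul_sp_positive_sum w l :
  sp w * positive_sum l = positive_sum [seq (alpha w c.1, (w * c.2)%g) | c <-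
    l].
Proof.
rewrite /positive_sum big_map mulr_sumr; apply: eq_bigr => c _.
by rewrite mulrA sp_phi spM mulrA.
Qed.

(* Rather than closing the set F of normal forms under products, show that the
   subring of all y with y F in F contains the generators, and that 1 is in F.
     *)
Lemma corner_skew_normal_form x : exists s l, x = sm s * positive_sum l.
Proof.
pose F x := exists s l, x = sm s * positive_sum l.
have FB y z : F y -> F z -> F (y - z).
  move=> [s [l ->]] [t [k ->]]; have [u [v uv]] := ore s t.
  (* Common denominators: r_- = (w r)_- w_+, applied with u s = v t. *)
  have lift r w : sm r = sm (w * r)%g * sp w by rewrite smM -mulrA sm_sp mulr1.
  rewrite (lift s u) (lift t v) -uv -!mulrA -mulrBr -(mulN1r (_ * _)).
  rewrite -(rmorph1 phi) -rmorphN !mul_sp_positive_sum mul_phi_positive_sum.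
  by exists (u * s)%g; eexists; rewrite /positive_sum -big_cat.
suff h y z : F z -> F (y * z).
  rewrite -/(F x) -[x]mulr1; apply: h; exists 1%g, [:: (1, 1%g)].
  by rewrite /positive_sum big_seq1 /= rmorph1 sm1 sp1 !mulr1.
move: y z; apply: (corner_skew_monoid_ring_ind hR).
- by move=> z; rewrite mul1r.
- by move=> y y' hy hy' z hz; rewrite mulrBl; apply: FB; auto.
- by move=> y y' hy hy' z hz; rewrite -mulrA; auto.
- move=> a _ [s [l ->]]; rewrite mulrA phi_sm -mulrA mul_phi_positive_sum.
  by exists s; eexists.
- by move=> w _ [s [l ->]]; rewrite mulrA -smM; exists (s * w)%g, l.
- move=> w _ [s [l ->]]; have [u [v uv]] := ore w s.
  (* With u w = v s one has w_+ s_- = u_- u_+ w_+ s_- = u_- v_+ s_+ s_- = u_- v_+ p_s. *)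
  have -> : sp w * (sm s * positive_sum l) = sm u * (sp v * (phi (p s) *
    positive_sum l)).
    by rewrite -sp_sm !mulrA -(mulrA _ (sp v)) -spM -uv spM mulrA sm_sp mul1r.
  by rewrite mul_phi_positive_sum mul_sp_positive_sum; exists u; eexists.
Qed.

Hypothesis hsimple : simple_ring A.
Hypothesis hcorner : compresses_to_corner alpha.
Hypothesis hproper : exists u, alpha u 1 <> 1.
Hypothesis houter : outer_action alpha.

(** Multiplying by t_- on the right turns a t_+ into a p_t = a; then x a y = p_s and s_- p_s s_+ =
    1. *)
Lemma monomial_divides_one a t : a * p t = a -> a <> 0 ->
  exists X Y, X * (phi a * sp t) * Y = 1.
Proof.
move=> ap a0; have [x [y [s xay]]] := hcorner a0.
exists (sm s * phi x), (sm t * phi y * sp s).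
rewrite !mulrA (mulr2E (sp_sm t)) -!(mulrA (sm s)) -!rmorphM.
by rewrite -(mulrA x) ap xay phi_corner_sp sm_sp.
Qed.

(** Induction on the length: [separate] yields x, y that kill the first term of [l] and keep the
    leading coefficient nonzero, while every other term keeps its exponent. *)
Lemma leading_term_divides_one a t l : a * p t = a -> a <> 0 ->
    all (fun c => c.2 != t) l ->
  exists X Y, X * (phi a * sp t + positive_sum l) * Y = 1.
Proof.
have [n] := ubnP (size l); elim: n a l => // n IH a [|[b s] l] /= hn ap a0.
  by move=> _; rewrite /positive_sum big_nil addr0; apply: monomial_divides_one.
move=> /andP[/eqP st lt].
have [x [y [h1 h2]]] : exists x y, x * a * alpha t y <> 0 /\ x * (b * p s) *
  alpha s y = 0.
  apply: (separate halpha hsimple hcorner hproper) => //.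
    by apply: houter => ts; apply: st.
  by rewrite -mulrA -(alphaM halpha) mulr1.
pose l' := [seq (x * c.1 * alpha c.2 y, c.2) | c <- l].
have [||||X [Y XY]] := IH (x * a * alpha t y) l'.
- by rewrite size_map.
- by rewrite -[_ * p t]mulrA (alphaM1 halpha).
- by [].
- by rewrite all_map.
exists (X * phi x), (phi y * Y); rewrite -XY.
have step c r : phi x * (phi c * sp r) * phi y = phi (x * c * alpha r y) * sp r.
  by rewrite !mulrA -[X in X = _]mulrA sp_phi !rmorphM !mulrA.
have -> : X * phi x * (phi a * sp t + positive_sum ((b, s) :: l)) * (phi y * Y)
  =
    X * (phi x * (phi a * sp t + positive_sum ((b, s) :: l)) * phi y) * Y.
  by rewrite !mulrA.
congr (_ * _ * _); rewrite /positive_sum big_cons /= !mulrDr !mulrDl !step.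
have -> : x * b * alpha s y = 0.
  by rewrite -(alpha1M halpha) !mulrA; rewrite mulrA in h2.
rewrite rmorph0 mul0r add0r; congr (_ + _).
by rewrite big_map mulr_sumr mulr_suml; apply: eq_bigr => c _; rewrite step.
Qed.

(** All terms with the exponent t of the first one are collected into a single coefficient, which
    matters only through its product with p_t. If that product vanishes, a shorter sum remains. *)
Lemma positive_sum_divides_one l : positive_sum l <> 0 ->
  exists X Y, X * positive_sum l * Y = 1.
Proof.
have [n] := ubnP (size l); elim: n l => // n IH [|[a t] l] /= hn l0.
  by case: l0; rewrite /positive_sum big_nil.
pose a' := a + \sum_(c <- l | c.2 == t) c.1.
pose l' := [seq c <- l | c.2 != t].
have lE : positive_sum ((a, t) :: l) = phi (a' * p t) * sp t + positive_sum l'.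
  rewrite rmorphM -mulrA phi_corner_sp /positive_sum big_cons /= rmorphD mulrDl.
  rewrite -addrA big_filter (bigID (fun c => c.2 == t)) /=; congr (_ + (_ + _)).
  by rewrite rmorph_sum mulr_suml; apply: eq_bigr => c /eqP ->.
have [a0|a0] := pselect (a' * p t = 0).
  move: l0; rewrite lE a0 rmorph0 mul0r add0r; apply: IH.
  by apply: (leq_ltn_trans _ (hn : size l < n)%N); rewrite size_filter
    count_size.
rewrite lE; apply: leading_term_divides_one => //.
  by rewrite -mulrA (alphaM1 halpha).
by rewrite /l' all_filter; apply/allP => c _; apply/implyP.
Qed.

(** Multiplication by s_+ clears the denominator and loses nothing, because s_- s_+ s_- = s_-. *)
Lemma nonzero_divides_one (x : R) : x <> 0 -> exists X Y, X * x * Y = 1.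
Proof.
have [s [l xE]] := corner_skew_normal_form x => x0.
have yE : sp s * x = positive_sum [seq (p s * c.1, c.2) | c <- l].
  by rewrite -mul_phi_positive_sum xE mulrA sp_sm.
have [|X [Y XY]] := @positive_sum_divides_one [seq (p s * c.1, c.2) | c <- l].
  rewrite -yE => y0; apply: x0.
  by rewrite xE -[sm s]mul1r -(sm_sp s) -!mulrA -xE y0 mulr0.
by exists (X * sp s), Y; rewrite -(mulrA X) yE.
Qed.

End CornerSkewMonoidRing.

(** * Endomorphism rings of abelian groups and of their quotients *)

Section EndomorphismRing.
Variable V : zmodType.

Definition is_endo (f : V -> V) : bool := `[< zmod_morphism f >].

Lemma is_endo_closed : zmod_closed is_endo.
Proof.
split=> [|f g /asboolP hf /asboolP hg]; apply/asboolP => x y.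
  by rewrite subrr.
rewrite -[LHS]/(f (x - y) - g (x - y)) -[RHS]/((f x - g x) - (f y - g y)).
by rewrite hf hg opprD [in RHS]opprD addrACA.
Qed.

Definition endo : Type := {f : V -> V | is_endo f}.

HB.instance Definition _ := SubChoice.on endo.
HB.instance Definition _ :=
  GRing.SubChoice_isSubZmodule.Build (V -> V) is_endo endo is_endo_closed.

Lemma endo_zmod_morphism (f : endo) : zmod_morphism (val f).
Proof. exact/asboolP/(valP f). Qed.

Lemma idfun_is_endo : is_endo idfun.
Proof. exact/asboolP. Qed.

Lemma comp_is_endo (f g : endo) : is_endo (val f \o val g).
Proof. by apply/asboolP => x y /=; rewrite !endo_zmod_morphism. Qed.

Definition endo_one : endo := exist is_endo idfun idfun_is_endo.
Definition endo_mul (f g : endo) : endo := exist is_endo _ (comp_is_endo f g).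

Lemma endo_mulA : associative endo_mul.
Proof. by move=> f g h; apply: val_inj. Qed.
Lemma endo_mul1 : left_id endo_one endo_mul.
Proof. by move=> f; apply: val_inj. Qed.
Lemma endo_1mul : right_id endo_one endo_mul.
Proof. by move=> f; apply: val_inj. Qed.
Lemma endo_mulDl : left_distributive endo_mul +%R.
Proof. by move=> f g h; apply: val_inj; apply: funext. Qed.
Lemma endo_mulDr : right_distributive endo_mul +%R.
Proof.
move=> f g h; apply: val_inj; apply: funext => x.
rewrite -[LHS]/(val f (val g x + val h x)) -[RHS]/(val f (val g x) + val f (val
  h x)).
have hf := endo_zmod_morphism f.
have f0 : val f 0 = 0 by rewrite -{1}(subrr 0) hf subrr.
have hN y : val f (- y) = - val f y by rewrite -[- y]sub0r hf f0 sub0r.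
by rewrite -{1}[val h x]opprK hf hN opprK.
Qed.

HB.instance Definition _ := GRing.Zmodule_isPzRing.Build endo
  endo_mulA endo_mul1 endo_1mul endo_mulDl endo_mulDr.

End EndomorphismRing.

Section QuotientEndomorphism.
Local Open Scope quotient_scope.
Variables (W : zmodType) (K : zmodClosed W).
Local Notation Q := (Quotient.quot K).

Lemma quot_eq (x y : W) : x - y \in K -> \pi_Q x = \pi_Q y.
Proof. by rewrite Quotient.idealrBE => /eqP. Qed.

Variable g : W -> W.
Hypotheses (gB : zmod_morphism g) (gK : forall x, x \in K -> g x \in K).

Definition quot_map (x : Q) : Q := \pi_Q (g (repr x)).

Lemma quot_mapE w : quot_map (\pi_Q w) = \pi_Q (g w).
Proof.
apply: quot_eq; rewrite -gB; apply: gK.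
by rewrite Quotient.idealrBE reprK.
Qed.

Lemma quot_map_is_endo : is_endo quot_map.
Proof.
apply/asboolP => x y; rewrite -[x]reprK -[y]reprK.
have e a b : \pi_Q a - \pi_Q b = \pi_Q (a - b) by rewrite raddfB.
by rewrite e !quot_mapE gB e.
Qed.

Definition quot_endo : endo Q := exist (@is_endo _) quot_map quot_map_is_endo.

End QuotientEndomorphism.

Lemma quot_endo_comp (W : zmodType) (K : zmodClosed W) (f g h : W -> W) fB fK
  gB gK hB hK :
  (forall w, f (g w) - h w \in K) ->
  @quot_endo W K f fB fK * @quot_endo W K g gB gK = @quot_endo W K h hB hK.
Proof.
move=> fgh; apply: val_inj; apply: funext => x; rewrite -[x]reprK.
by rewrite [LHS]/= !quot_mapE //; apply: quot_eq.
Qed.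

Lemma quot_endo_comm (W : zmodType) (K : zmodClosed W) (f g f' g' : W -> W)
    fB fK gB gK fB' fK' gB' gK' :
  (forall w, f (g w) - f' (g' w) \in K) ->
  @quot_endo W K f fB fK * @quot_endo W K g gB gK =
  @quot_endo W K f' fB' fK' * @quot_endo W K g' gB' gK'.
Proof.
move=> fgh; apply: val_inj; apply: funext => x; rewrite -[x]reprK.
by rewrite [LHS]/= [RHS]/= !quot_mapE //; apply: quot_eq.
Qed.

(** * A nonzero model of the relations, showing that R is nonzero *)

Section Model.
Local Open Scope quotient_scope.
Variables (S : monoidType) (A : pzRingType) (alpha : S -> A -> A).
Hypothesis halpha : corner_action alpha.
Hypothesis hsimple : simple_ring A.
Hypothesis ore : forall s t : S, exists u v, (u * s = v * t)%g.
Hypothesis cancel : forall s t w : S, (s * w = t * w)%g -> s = t.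

Let p s := alpha s 1.
Local Notation W := (S -> A).

Let pp s t : p (s * t)%g * p s = p (s * t)%g.
Proof. by rewrite /p (corner_action_mul halpha) (alphaM1 halpha). Qed.
Let pp' s t : p s * p (s * t)%g = p (s * t)%g.
Proof. by rewrite /p (corner_action_mul halpha) (alpha1M halpha). Qed.
Let p2 s : p s * p s = p s.
Proof. exact: (alphaM1 halpha). Qed.

(* The model acts on functions v : S -> A up to [eventually_null] functions,
   v r standing for the class of r_- v(r) in R / sum_t R (t_+ - 1).  Here
   eventually means on some set S s0; these form a filter base by [ore]. *)
Definition eventually_null (v : W) : bool :=
  `[< exists s0, forall u, p (u * s0)%g * v (u * s0)%g = 0 >].

Lemma eventually_nullP (v : W) s0 :
  (forall u, p (u * s0)%g * v (u * s0)%g = 0) -> eventually_null v.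
Proof. by move=> h; apply/asboolP; exists s0. Qed.

Lemma eventually_null_closed : zmod_closed eventually_null.
Proof.
split=> [|v w /asboolP[s hs] /asboolP[t ht]].
  by apply: (@eventually_nullP _ 1%g) => u; rewrite mulr0.
have [a [b ab]] := ore s t.
apply: (@eventually_nullP _ (a * s)%g) => u.
rewrite mulrBr mulgA hs sub0r -mulgA ab mulgA.
by rewrite ht oppr0.
Qed.

Let K : zmodClosed W := HB.pack eventually_null
  (GRing.isZmodClosed.Build _ eventually_null eventually_null_closed).

(** The three formulas come from a r_- = r_- alpha_r(a), w_+ (r w)_- = r_- p_{rw} and w_- q_- = (q
    w)_-. *)
Definition act (a : A) (v : W) : W := fun r => alpha r a * v r.
Definition shift_plus w (v : W) : W := fun r => p (r * w)%g * v (r * w)%g.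
(** The q with q w = r is unique by [cancel]. The default 0 outside S w is harmless: by [ore] every
    S s0 contains some S (u s0) lying in S w. *)
Definition shift_minus w (v : W) : W := fun r =>
  if pselect (exists q, (q * w = r)%g) is left h then p r * v (projT1 (cid h))
  else 0.

Lemma shift_minusE w v q : shift_minus w v (q * w)%g = p (q * w)%g * v q.
Proof.
rewrite /shift_minus; case: pselect => [h|[]]; last by exists q.
by case: cid => q' /= /cancel ->.
Qed.

Lemma act_zmod a : zmod_morphism (act a).
Proof. by move=> x y; apply: funext => r; apply: mulrBr. Qed.
Lemma shift_plus_zmod w : zmod_morphism (shift_plus w).
Proof. by move=> x y; apply: funext => r; apply: mulrBr. Qed.
Lemma shift_minus_zmod w : zmod_morphism (shift_minus w).
Proof.
move=> x y; apply: funext => r.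
rewrite -[RHS]/(shift_minus w x r - shift_minus w y r) /shift_minus.
by case: pselect => h; [apply: mulrBr | rewrite subr0].
Qed.

Lemma act_null a x : x \in K -> act a x \in K.
Proof.
move=> /asboolP[s hs]; apply: (@eventually_nullP _ s) => u.
by rewrite /act mulrA (alpha1M halpha) -(alphaM1 halpha) -mulrA hs mulr0.
Qed.
Lemma shift_plus_null w x : x \in K -> shift_plus w x \in K.
Proof.
move=> /asboolP[s hs]; have [a [b ab]] := ore w s.
apply: (@eventually_nullP _ a) => u.
by rewrite /shift_plus -mulgA ab mulgA hs mulr0.
Qed.
Lemma shift_minus_null w x : x \in K -> shift_minus w x \in K.
Proof.
move=> /asboolP[s hs]; apply: (@eventually_nullP _ (s * w)%g) => u.
by rewrite mulgA shift_minusE mulrA p2 -pp -mulrA hs mulr0.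
Qed.

Let T : pzRingType := endo (Quotient.quot K).
Let phi0 a : T := quot_endo (act_zmod a) (@act_null a).
Let sp w : T := quot_endo (shift_plus_zmod w) (@shift_plus_null w).
Let sm w : T := quot_endo (shift_minus_zmod w) (@shift_minus_null w).

Let K_eq (v w : W) s0 :
  (forall u, p (u * s0)%g * v (u * s0)%g = p (u * s0)%g * w (u * s0)%g) ->
  v - w \in K.
Proof.
move=> h; apply: (@eventually_nullP _ s0) => u.
by rewrite -[(v - w) _]/(v _ - w _) mulrBr h subrr.
Qed.
Let K_ext (v w : W) : (forall r, v r = w r) -> v - w \in K.
Proof. by move=> h; apply: (@K_eq _ _ 1%g) => u; rewrite h. Qed.

Let quot_endo1 f (fB : zmod_morphism f) fK : (forall w, f w - w \in K) ->
  quot_endo (K := K) fB fK = 1.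
Proof.
move=> h; apply: val_inj; apply: funext => x; rewrite -[x]reprK /=.
by rewrite quot_mapE //; apply: quot_eq.
Qed.

Let phi0_zmod : zmod_morphism phi0.
Proof.
move=> a b; apply: val_inj; apply: funext => x; rewrite -[x]reprK.
rewrite -[RHS]/(val (phi0 a) _ - val (phi0 b) _) /= !quot_mapE; try exact:
  act_zmod; try exact: act_null.
rewrite -raddfB; congr (\pi _); apply: funext => r.
by rewrite /act (alphaB halpha) mulrBl.
Qed.
Let phi0_monoid : monoid_morphism phi0.
Proof.
split=> [|a b].
  by apply: quot_endo1 => v; apply: (@K_eq _ _ 1%g) => u; rewrite /act mulrA p2.
apply/esym; apply: quot_endo_comp => v; apply: K_ext => r.
by rewrite /act (alphaM halpha) mulrA.
Qed.
Let phi : {rmorphism A -> T} := HB.pack phi0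
  (GRing.isZmodMorphism.Build _ _ phi0 phi0_zmod)
  (GRing.isMonoidMorphism.Build _ _ phi0 phi0_monoid).

Lemma model_relations : corner_skew_relations alpha phi sm sp.
Proof.
split.
- apply: quot_endo1 => v; apply: (@K_eq _ _ 1%g) => u.
  by rewrite shift_minusE mulrA p2 mulg1.
- move=> s u; apply/esym; apply: quot_endo_comp => v.
  apply: (@K_eq _ _ (s * u)%g) => q; rewrite shift_minusE mulgA !shift_minusE.
  by rewrite !mulrA -(mulrA _ _ (p (q * s)%g)) pp.
- apply: quot_endo1 => v; apply: (@K_eq _ _ 1%g) => u.
  by rewrite /shift_plus !mulg1 mulrA p2.
- move=> s u; apply/esym; apply: quot_endo_comp => v; apply: K_ext => r.
  by rewrite /shift_plus mulrA mulgA pp'.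
- move=> t a; apply: quot_endo_comm => v; apply: K_ext => r.
  rewrite /shift_plus /act -(corner_action_mul halpha).
  by rewrite !mulrA (alpha1M halpha) (alphaM1 halpha).
- move=> s a; apply: quot_endo_comm => v; apply: (@K_eq _ _ s) => q.
  rewrite {1}/act !shift_minusE /act -(corner_action_mul halpha) !mulrA.
  by rewrite -[X in X * _ = _]mulrA (alphaM1 halpha) p2.
(* The product is compared with the endomorphism induced by the identity map, so that
   [quot_endo_comp] applies. *)
- move=> s; rewrite [LHS](_ : _ = quot_endo (fun x y => erefl (x - y)) (fun x
    hx => hx)).
    by apply: quot_endo1 => v; apply: K_ext.
  apply: quot_endo_comp => v; apply: (@K_eq _ _ s) => q.
  by rewrite shift_minusE /shift_plus !mulrA !p2.
- move=> s; apply: quot_endo_comp => v; apply: K_ext => r.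
  by rewrite /shift_plus shift_minusE /act mulrA p2 -(corner_action_mul halpha).
Qed.

(** The constant function 1 is not eventually null, because p_s <> 0 for every s. *)
Lemma model_nonzero : (1 : T) <> 0.
Proof.
move=> /(congr1 (fun f : T => val f (\pi_(Quotient.quot K) (fun=> 1)))) /=.
move=> h; have : \pi_(Quotient.quot K) (fun=> 1) = \pi_(Quotient.quot K) (0 :
  W).
  by rewrite raddf0.
move=> /eqP; rewrite -Quotient.idealrBE subr0 => /asboolP[s /(_ 1%g)].
by rewrite mulr1 -(alpha0 halpha (1 * s)%g) => /(alpha_inj halpha); case:
  hsimple.
Qed.

End Model.

Lemma corner_skew_monoid_ring_nonzero (S : monoidType) (A R : pzRingType)
    (alpha : S -> A -> A) (phi : {rmorphism A -> R}) (sm sp : S -> R) :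
  corner_action alpha -> simple_ring A ->
  (forall s t : S, exists u v, (u * s = v * t)%g) ->
  (forall s t w : S, (s * w = t * w)%g -> s = t) ->
  corner_skew_monoid_ring alpha phi sm sp -> (1 : R) <> 0.
Proof.
move=> halpha hsimple ore cancel [_ huniv] R0.
have [h _ _] := huniv _ _ _ _ (model_relations halpha ore cancel).
case: (model_nonzero halpha hsimple (ore := ore)).
by rewrite -(rmorph1 h) R0 rmorph0.
Qed.

(** * Matrix ranks and ultramatricial algebras *)

Section MatrixRank.
Variables (k : fieldType) (n : nat).
Implicit Types A B : 'M[k]_n.+1.

(** In rank normal form, the product of the partial identities of ranks rank B and rank A is the one
    of rank B. *)
Lemma rank_le_factor A B : (\rank B <= \rank A)%N -> exists X Y, X * A * Y = B.
Proof.
move=> le_BA.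
exists (col_ebase B *m pid_mx (\rank B) *m invmx (col_ebase A)).
exists (invmx (row_ebase A) *m row_ebase B).
rewrite -{2}(mulmx_ebase A) -[RHS]mulmx_ebase -!mulmxE !mulmxA.
rewrite mulmxKV ?col_ebase_unit // mulmxK ?row_ebase_unit //.
rewrite -[_ *m pid_mx _ *m pid_mx _]mulmxA mul_pid_mx; congr (_ *m pid_mx _ *m
  _).
have := rank_leq_row B; lia.
Qed.

(** Frobenius' rank inequality for A (A + B) B, where A (A + B) = A, (A + B) B = B and the triple
    product is 0. *)
Lemma rank_orthogonal_idempotents A B : A * A = A -> B * B = B -> A * B = 0 ->
  (\rank A + \rank B <= \rank (A + B)%R)%N.
Proof.
move=> AA BB AB; have := mxrank_Frobenius A (A + B) B.
rewrite !mulmxE mulrDr AA AB addr0 mulrDl BB AB add0r.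
by rewrite mxrank0 addn0.
Qed.

End MatrixRank.

(** Bernoulli's inequality (1 + 1/K)^m >= 1 + m/K with denominators cleared. *)
Lemma bernoulli_expn K m : ((K + m) * K ^ m <= K * K.+1 ^ m)%N.
Proof.
elim: m => [|m IH]; first by rewrite addn0.
rewrite !expnS.
apply: (@leq_trans (K.+1 * ((K + m) * K ^ m))); last by rewrite [leqRHS]mulnCA
  leq_mul2l IH orbT.
nia.
Qed.

Section Ultramatricial.
Variables (k : fieldType) (B : algType k) (b : B -> B).
Hypotheses (bD : {morph b : x y / x + y}) (bM : {morph b : x y / x * y}).
Hypothesis hfull : forall a : B, a <> 0 -> generates_one a.
Hypothesis hproper : b 1 <> 1.

Lemma finite_stage (F : nat -> set B) :
  (forall n, F n `<=` F n.+1)%classic -> (\bigcup_n F n = [set: B])%classic ->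
  forall l : seq B, exists n, forall x, x \in l -> F n x.
Proof.
move=> Fmono Fcover.
have mono n d x : F n x -> F (n + d)%N x.
  by elim: d => [|d IH] hx; rewrite ?addn0 // addnS; apply: Fmono; apply: IH.
elim=> [|x l [n hn]]; first by exists 0%N.
have [m _ hm] : (\bigcup_n F n)%classic x by rewrite Fcover.
exists (m + n)%N => y; rewrite inE => /orP[/eqP->|/hn hy]; first exact: mono.
by rewrite addnC; apply: mono.
Qed.

Let bi i := iter i b.
Let biD i : {morph bi i : x y / x + y}.
Proof. by move=> x y; rewrite /bi; elim: i => //= i ->; rewrite bD. Qed.
Let biM i : {morph bi i : x y / x * y}.
Proof. by move=> x y; rewrite /bi; elim: i => //= i ->; rewrite bM. Qed.
Let bi0 i : bi i 0 = 0.
Proof. by apply: (addrI (bi i 0)); rewrite -biD !addr0. Qed.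

(** Let q = 1 - b(1), write 1 as a sum of N terms x q y and of M terms x a y. In each matrix block
    the rank of b^i(1) shrinks by a factor (N - 1)/N when i grows by one, while rank 1 <= M rank a.
    As N and M do not depend on the block, one m works for all blocks. *)
Lemma ultramatricial_iter_factor (a : B) : ultramatricial B -> a <> 0 ->
  exists x y m, x * a * y = iter m b 1.
Proof.
move=> [F [Fsub Fmono Fcover Fmat]] a0.
pose q := 1 - b 1.
have q0 : q <> 0 by move=> /subr0_eq/esym.
have [l hl] := hfull q0.
have [l' hl'] := hfull a0.
pose N := size l; pose M := size l'.
have N0 : (0 < N)%N.
  rewrite /N; case: (l) hl => //; rewrite big_nil => /esym/eqP.
  by rewrite oner_eq0.
(* Bernoulli needs K M <= K + m; the extra 1 makes K ^ m vanish when K = 0. *)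
pose K := N.-1; pose m := (K * M + 1)%N.
have hm : (K ^ m * M <= N ^ m)%N.
  have -> : N = K.+1 by rewrite /K; lia.
  have [K0|K0] := posnP K; first by rewrite K0 /m addn1 exp0n.
  rewrite -(leq_pmul2l K0); apply: leq_trans (bernoulli_expn K m).
  by rewrite [leqRHS]mulnC mulnCA leq_mul2l /m; apply/orP; right; lia.
(* [b] need not respect the stages [F n], so m is fixed first and then one stage is chosen that
   contains the images under b^i, i <= m, of all elements used in the estimates. *)
pose xs := [:: q; 1] ++ unzip1 l ++ unzip2 l.
pose big := flatten [seq [seq bi i x | x <- xs] | i <- iota 0 m.+1].
have [n hn] := finite_stage Fmono Fcover (a :: big ++ unzip1 l' ++ unzip2 l').
have [C1 CD CM] := Fsub n.
have [r [d [f [f1 fD fM [_ finj fsurj]]]]] := Fmat n.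
have Ca : F n a by apply: hn; rewrite inE eqxx.
have Cbi i x : (i <= m)%N -> x \in xs -> F n (bi i x).
  move=> im hx; apply: hn; have : bi i x \in big.
    apply/flattenP; exists [seq bi i x | x <- xs]; last exact: map_f.
    by apply: (map_f (fun i => [seq bi i x | x <- xs])); rewrite mem_iota.
  by move: big => bg hbg; rewrite inE mem_cat hbg orbT.
have C0 : F n 0 by rewrite -(subrr 1) addrC -scaleN1r; apply: CD.
have CA x y : F n x -> F n y -> F n (x + y) by rewrite -{2}[x]scale1r; apply:
  CD.
have fA x y j : F n x -> F n y -> f (x + y) j = f x j + f y j.
  by move=> hx hy; rewrite -{1}[x]scale1r fD // scale1r.
have f0 j : f 0 j = 0 by apply: (addrI (f 0 j)); rewrite -fA // !addr0.
pose rk j x : nat := \rank (f x j).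
have rk_sum j (s : seq (B * B)) x : F n x ->
    (forall c, c \in s -> F n c.1 /\ F n c.2) ->
  F n (\sum_(c <- s) c.1 * x * c.2) /\
  (rk j (\sum_(c <- s) c.1 * x * c.2)%R <= size s * rk j x)%N.
  move=> hx; elim: s => [|c s IH] hs; first by rewrite big_nil /rk f0 mxrank0.
  have [|h1 h2] := IH; first by move=> c' hc; apply: hs; rewrite inE hc orbT.
  have [c1 c2] := hs c (mem_head _ _).
  have hc : F n (c.1 * x * c.2) by apply/CM => //; apply/CM.
  rewrite big_cons; split; first exact: CA.
  rewrite /rk fA // mulSn; apply: leq_trans (mxrank_add _ _) _.
  apply: leq_add => //; rewrite !fM //; last exact/CM.
  by apply: leq_trans (mxrankM_maxl _ _) _; apply: mxrankM_maxr.
have pE i : bi i 1 = bi i q + bi i.+1 1.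
  by rewrite /bi iterSr -biD /q subrK.
(* From 1 in A q A, p_i = b^i(q) + p_{i+1} has rank at most N rk(b^i(q)). *)
have rk_step j i : (i < m)%N -> (N * rk j (bi i.+1 1) <= K * rk j (bi i 1))%N.
  move=> im; have im' := ltnW im.
  have hq : F n (bi i q) by apply/Cbi; rewrite // !inE eqxx.
  have hp : F n (bi i.+1 1) by apply/Cbi; rewrite // !inE eqxx orbT.
  have bb : bi i.+1 1 * bi i.+1 1 = bi i.+1 1 by rewrite -biM mulr1.
  have bE : bi i.+1 1 = bi i (b 1) by rewrite /bi iterSr.
  have b1 : b 1 * b 1 = b 1 by rewrite -bM mulr1.
  have qq : bi i q * bi i q = bi i q.
    by rewrite -biM /q mulrBl mul1r mulrBr mulr1 b1 subrr subr0.
  have qp : bi i q * bi i.+1 1 = 0.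
    by rewrite bE -biM /q mulrBl mul1r b1 subrr bi0.
  have h1 : (rk j (bi i q) + rk j (bi i.+1 1) <= rk j (bi i 1))%N.
    rewrite (pE i) /rk fA //.
    by apply: rank_orthogonal_idempotents; rewrite -fM // ?qq ?bb ?qp ?f0.
  have h2 : (rk j (bi i 1) <= N * rk j (bi i q))%N.
    have e : bi i 1 = \sum_(c <- [seq (bi i c.1, bi i c.2) | c <- l]) c.1 * bi
      i q * c.2.
      rewrite big_map -hl (big_morph _ (biD i) (bi0 i)).
      by apply: eq_bigr => c _; rewrite !biM.
    rewrite e /N -(size_map (fun c => (bi i c.1, bi i c.2)) l).
    apply: (rk_sum j _ _ hq _).2 => _ /mapP[c hc ->] /=.
    by split; apply/Cbi; rewrite // !inE !mem_cat ?(map_f fst hc) ?(map_f snd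
      hc) ?orbT.
  rewrite /K; nia.
have rk_iter j i : (i <= m)%N -> (N ^ i * rk j (bi i 1) <= K ^ i * rk j 1%R)%N.
  elim: i => // i IH im; rewrite !expnS.
  have := rk_step j i im; have := IH (ltnW im); nia.
have rk_le j : (rk j (bi m 1) <= rk j a)%N.
  have := rk_iter j m (leqnn m).
  have h1 : (rk j 1%R <= M * rk j a)%N.
    rewrite -hl'; apply: (rk_sum j _ _ Ca _).2 => c hc.
    by split; apply: hn; rewrite inE !mem_cat ?(map_f fst hc) ?(map_f snd hc)
      ?orbT.
  move=> h2; rewrite -(@leq_pmul2l (N ^ m)) ?expn_gt0 ?N0 //.
  apply: leq_trans h2 _; apply: (@leq_trans (K ^ m * (M * rk j a))).
    by rewrite leq_mul2l h1 orbT.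
  by rewrite mulnA leq_mul2r hm orbT.
(* The factors are chosen block by block and then lifted to the stage through surjectivity of
   [f]. *)
have hXY j : {XY : ('M[k]_((d j).+1) * 'M[k]_((d j).+1))%type | XY.1 * f a j *
  XY.2 = f (bi m 1) j}.
  by apply: cid; have [X [Y XY]] := rank_le_factor (rk_le j); exists (X, Y).
have [x Cx fx] := fsurj [ffun j => (proj1_sig (hXY j)).1] I.
have [y Cy fy] := fsurj [ffun j => (proj1_sig (hXY j)).2] I.
exists x, y, m; apply: finj.
- by rewrite inE; apply/CM => //; apply/CM.
- by rewrite inE; apply/Cbi; rewrite // !inE eqxx orbT.
- by apply/ffunP => j; rewrite !fM ?fx ?fy ?ffunE ?(proj2_sig (hXY j)) //;
    apply/CM.
Qed.

End Ultramatricial.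

(** * Purely infinite simple rings and the condition x a y = 1 *)

Section PurelyInfinite.
Variable T : pzRingType.

(** If x s = 1 with e = s x in J, then t -> s t x identifies T with e T e. It carries the proper
    idempotent v w to e1 < e, and left multiplication by s v x maps e T isomorphically onto e1 T,
    with inverse s w x. *)
Lemma purely_infinite_simple_of_division (v w : T) :
  (1 : T) <> 0 -> w * v = 1 -> v * w <> 1 ->
  (forall x : T, x <> 0 -> exists y z, y * x * z = 1) ->
  purely_infinite_simple T.
Proof.
move=> T0 wv vw hdiv; split; first split=> //.
  move=> J [[J0 JD JM] JMl].
  have [[x [Jx x0]]|h] := pselect (exists x, J x /\ x <> 0).
    have [y [z yxz]] := hdiv x x0.
    right; apply/seteqP; split=> // t _; rewrite -[t]mul1r -yxz -!mulrA.
    by apply: JMl; apply: JM.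
  left; apply/seteqP; split=> [x Jx|_ ->] //.
  by apply: contrapT => x0; apply: h; exists x.
move=> J [J0 JD JM] Jn0.
have [r Jr r0] : exists2 r, J r & r <> 0.
  apply: contrapT => h; apply: Jn0; apply/seteqP; split=> [x Jx|_ ->] //.
  by apply: contrapT => x0; apply: h; exists x.
have [x [y xry]] := hdiv r r0.
have [s xs Js] : exists2 s, x * s = 1 & J (s * x).
  by exists (r * y); rewrite ?mulrA // -mulrA; apply: JM.
exists (s * x) => //.
have [e eE] : exists e, e = s * x by eexists.
have [e1 e1E] : exists e1, e1 = s * v * w * x by eexists.
have ee : e * e = e by rewrite eE mulrA (mulr2E xs) mulr1.
have ee1 : e * e1 = e1 by rewrite eE e1E !mulrA (mulr2E xs) mulr1.
have e1e : e1 * e = e1 by rewrite eE e1E mulrA (mulr2E xs) mulr1.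
have e11 : e1 * e1 = e1.
  by rewrite e1E !mulrA (mulr2E xs) mulr1 (mulr2E wv) mulr1.
have prid (c : T) : right_ideal (principal_right_ideal c).
  split=> [|_ _ [a _ <-] [b _ <-]|_ b [a _ <-]].
  - by exists 0; rewrite ?mulr0.
  - by exists (a + b); rewrite ?mulrDr.
  - by exists (a * b); rewrite ?mulrA.
rewrite -eE; split=> //; exists (principal_right_ideal e1); split.
- exists (principal_right_ideal (e - e1)); split=> //.
    apply/seteqP; split=> [z [[a _ <-] [b _]]|_ ->]; last by split; exists 0;
      rewrite ?mulr0.
    move=> /(congr1 (fun t => e1 * t)); rewrite (mulrA e1) mulrBr e1e e11 subrr
      mul0r.
    by rewrite mulrA e11 => /esym.
  apply/seteqP; split=> [_ [a _ <-]|_ [_ [a _ <-] [_ [b _ <-] <-]]].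
    exists (e1 * a); first by exists a.
    exists ((e - e1) * a); first by exists a.
    by rewrite -mulrDl addrC subrK.
  exists (e1 * a + (e - e1) * b) => //.
  by rewrite -?eE mulrDr !mulrA mulrBr ee ee1.
- move=> E; have : principal_right_ideal e1 e by rewrite E; exists e; rewrite
    // -?eE ee.
  move=> [a _ ae]; apply: vw.
  have e1e' : e1 = e by rewrite -e1e -{1}ae mulrA e11 ae.
  have <- : x * e1 * s = v * w by rewrite e1E !mulrA xs mul1r -mulrA xs mulr1.
  by rewrite e1e' eE !mulrA xs mul1r xs.
- have fe t : s * v * x * (e * t) = s * v * x * t.
    by rewrite eE !mulrA (mulr2E xs) mulr1.
  exists (fun t => s * v * x * t); split.
  + by move=> a b _ _; rewrite mulrDr.
  + by move=> a b _; rewrite mulrA.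
  + split.
    * move=> _ [a _ <-]; exists (s * v * x * a) => //.
      by rewrite fe e1E !mulrA (mulr2E xs) mulr1 (mulr2E wv) mulr1.
    * move=> _ _ /set_mem[a _ <-] /set_mem[b _ <-] /(congr1 (fun t => s * w * x
        * t)).
      by rewrite !fe eE !mulrA (mulr2E xs) mulr1 (mulr2E wv) mulr1.
    * move=> _ [a _ <-]; exists (e * (s * w * x * a)); first by exists (s * w *
        x * a).
      by rewrite fe e1E !mulrA (mulr2E xs) mulr1.
Qed.

(** An isomorphism g from e T onto N is left multiplication by y = g(e). Writing e = n + n' along
    the decomposition, x comes from the preimage of n; y x = e would force N = e T. *)
Lemma infinite_idempotent_isometry (e : T) : infinite_idempotent e ->
  exists x y, [/\ x * y = e, e * y = y, y * e = y & e * x = x /\ x * e = x] /\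
    y * x <> e.
Proof.
move=> [ee [N [[N' [[N0 ND NM] [N'0 N'D N'M] NN' eE]] Ne [g [gD gM [gN ginj
  gsurj]]]]]].
have Psub t : principal_right_ideal e t -> e * t = t.
  by move=> [a _ <-]; rewrite mulrA ee.
have Pe t : principal_right_ideal e (e * t) by exists t.
have eP : principal_right_ideal e e by exists e.
have NP t : N t -> principal_right_ideal e t.
  by move=> Nt; rewrite eE; exists t => //; exists 0; rewrite ?addr0.
have [n Nn [n' Nn' enn]] : [set x + y | x in N & y in N']%classic e by rewrite
  -eE.
have nN t : N t -> n * t = t.
  move=> Nt; have : (N `&` N')%classic (t - n * t).
    have h : t - n * t = n' * t by rewrite -{1}(Psub t (NP t Nt)) -enn mulrDl
      addrC addKr.
    split; last by rewrite h; apply: N'M.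
    by apply: ND => //; rewrite -mulrN; apply: NM.
  by rewrite NN' => /subr0_eq.
have [z [a _ zE] gz] := gsurj n Nn.
have ez : e * z = z by rewrite -zE mulrA ee.
pose y := g e.
have Ny : N y by apply: gN.
have yz : y * z = n by rewrite -gM // ez.
have ye : y * e = y by rewrite -gM // ee.
exists (z * e), y; split; last first.
  rewrite mulrA yz => ne; apply: Ne; apply/seteqP; split=> // _ [b _ <-].
  by rewrite -ne -mulrA; apply: NM.
split; [|exact/Psub/NP|exact: ye|by rewrite mulrA ez -mulrA ee].
rewrite -mulrA (Psub y (NP y Ny)); apply: ginj; rewrite ?inE //.
  by rewrite -ez -mulrA.
by rewrite gM ?gz ?nN // -ez.
Qed.

(** Take an infinite idempotent e in a T and g = e - y x, so that g y = 0 and x g = 0. Then X' = c_1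
    g + X x and Y' = g c_2 + y Y satisfy X' e Y' = c_1 g c_2 + X e Y: arbitrarily long sums factor
    through e, including one equal to 1. *)
Lemma purely_infinite_simple_division : purely_infinite_simple T ->
  forall a : T, a <> 0 -> exists y z, y * a * z = 1.
Proof.
move=> [hsimple hinf] a a0.
have [||e [w _ eE] he] := hinf (principal_right_ideal a).
- split=> [|_ _ [b _ <-] [c _ <-]|_ b [c _ <-]].
  + by exists 0; rewrite ?mulr0.
  + by exists (b + c); rewrite ?mulrDr.
  + by exists (c * b); rewrite ?mulrA.
- move=> h; apply: a0; have : principal_right_ideal a a by exists 1; rewrite
    ?mulr1.
  by rewrite h.
have [x [y [[xy ey ye [ex xe]] yx]]] := infinite_idempotent_isometry he.
have ee := he.1.
have [g gE] : exists g, g = e - y * x by eexists.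
have g0 : g <> 0 by rewrite gE => /subr0_eq/esym.
have gy : g * y = 0 by rewrite gE mulrBl -mulrA xy ey ye subrr.
have xg : x * g = 0 by rewrite gE mulrBr xe mulrA xy ex subrr.
have eg : e * g = g by rewrite gE mulrBr ee mulrA ey.
have ge : g * e = g by rewrite gE mulrBl ee -mulrA xe.
have gg : g * g = g by rewrite {2}gE mulrBr ge mulrA gy mul0r subr0.
have [l hl] := simple_generates_one hsimple g0.
suff [X [Y XY]] : exists X Y, X * e * Y = \sum_(c <- l) c.1 * g * c.2.
  by exists X, (w * Y); rewrite -hl -XY -eE !mulrA.
elim: l {hl} => [|c l [X [Y IH]]].
  by exists 0, 0; rewrite big_nil mulr0.
exists (c.1 * g + X * x), (g * c.2 + y * Y); rewrite big_cons -IH.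
rewrite !mulrDl !mulrDr !mulrA (mulr2E ge) (mulr2E xe) !(mulr2E gg) (mulr2E gy).
by rewrite (mulr2E xg) (mulr2E xy) !mulr0 !mul0r addr0 add0r.
Qed.

End PurelyInfinite.

(** * The two cases for A and the conclusion *)

Section Corollary.
Variables (A : pzRingType) (G : groupType) (P : {pred G}) (S : subMonoidType P).
Hypothesis hG : forall g : G, exists s t : S, g = ((val s)^-1 * val t)%g.

Lemma left_ore (s t : S) : exists u v : S, (u * s = v * t)%g.
Proof.
have [u [v uv]] := hG (val t * (val s)^-1)%g.
exists v, u; apply: val_inj; rewrite !gmulfM /=.
by rewrite -[val t](mulgVK (val s)) uv !mulgA mulgV mul1g.
Qed.

Lemma submonoid_mulIg (s t w : S) : (s * w = t * w)%g -> s = t.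
Proof. by move/(congr1 val); rewrite !gmulfM => /mulIg /val_inj. Qed.

Variable alpha : S -> A -> A.
Hypothesis halpha : corner_action alpha.

Lemma purely_infinite_compresses :
  purely_infinite_simple A -> compresses_to_corner alpha.
Proof.
move=> h a a0; have [y [z yaz]] := purely_infinite_simple_division h a0.
by exists y, z, 1%g; rewrite (corner_action_one halpha).
Qed.

(** alpha_u is transported to [b] on the algebra [B]; the iterates of [b] correspond to alpha at the
    powers of u, so the required s is u^m. *)
Lemma ultramatricial_compresses : simple_ring A ->
  ultramatricial_over_some_field A -> (exists u, alpha u 1 <> 1) ->
  compresses_to_corner alpha.
Proof.
move=> hA [k [B [f [[g fK gK] hB]]]] [u hu] a a0.
have gD : {morph g : x y / x + y}.
  by move=> x y; apply: (can_inj fK); rewrite rmorphD !gK.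
have gM : {morph g : x y / x * y}.
  by move=> x y; apply: (can_inj fK); rewrite rmorphM !gK.
have f1 : f 1 = 1 by apply: rmorph1.
have f0 x : x <> 0 -> f x <> 0.
  by move=> x0 fx0; apply: x0; rewrite -[x]fK fx0 -(rmorph0 f) fK.
have g0 : g a <> 0 by move=> ga; apply: a0; rewrite -[a]gK ga rmorph0.
pose b x := g (alpha u (f x)).
have bD : {morph b : x y / x + y}.
  by move=> x y; rewrite /b rmorphD (alphaD halpha) gD.
have bM : {morph b : x y / x * y}.
  by move=> x y; rewrite /b rmorphM (alphaM halpha) gM.
have hfull (x : B) : x <> 0 -> generates_one x.
  move=> x0; have [l hl] := simple_generates_one hA (f0 x x0).
  exists [seq (g c.1, g c.2) | c <- l]; apply: (can_inj fK).
  rewrite f1 -hl big_map rmorph_sum; apply: eq_bigr => c _.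
  by rewrite !rmorphM !gK.
have b1 : b 1 <> 1.
  have bE : f (b 1) = alpha u 1 by rewrite /b gK; congr (alpha u _); exact: f1.
  by move=> b1; apply: hu; rewrite -bE b1; exact: f1.
have [x [y [m xay]]] := ultramatricial_iter_factor bD bM hfull b1 hB g0.
exists (f x), (f y), (u ^+ m)%g.
rewrite -[a]gK -!rmorphM xay.
elim: m {xay} => [|m IH]; first by rewrite expg0 (corner_action_one halpha) f1.
by rewrite expgS (corner_action_mul halpha) -IH /= {1}/b gK.
Qed.

End Corollary.

Theorem corollary5p4 (A : pzRingType) (G : groupType)
    (P : {pred G}) (S : subMonoidType P)
    (hG : forall g : G, exists s t : S, g = ((val s)^-1 * val t)%g)
    (alpha : S -> A -> A) (halpha : corner_action alpha)
    (hA : purely_infinite_simple A \/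
          (simple_ring A /\ ultramatricial_over_some_field A))
    (houter : outer_action alpha)
    (hu : exists u : S, alpha u 1 <> 1)
    (R : pzRingType) (phi : {rmorphism A -> R}) (sm sp : S -> R)
    (hR : corner_skew_monoid_ring alpha phi sm sp) :
  purely_infinite_simple R.
Proof.
have hsimple : simple_ring A by case: hA => [[]|[]].
have hcorner : compresses_to_corner alpha.
  case: hA => [|[_ hum]]; first exact: purely_infinite_compresses.
  exact: ultramatricial_compresses.
have R1 : (1 : R) <> 0.
  apply: (corner_skew_monoid_ring_nonzero halpha hsimple _ _ hR).
    exact: left_ore.
  exact: submonoid_mulIg.
have [u pu] := hu.
have [relR _] := hR.
apply: (@purely_infinite_simple_of_division _ (sp u) (sm u)) => //.
- exact: (corner_skew_minus_plus relR).
(* If phi(p_u) = 1, then phi kills 1 - p_u, which generates A as an ideal, and so 1 = 0 in R. *)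
- rewrite (corner_skew_plus_minus relR) => phi_pu.
  have q0 : 1 - alpha u 1 <> 0 by move=> /subr0_eq/esym.
  have [l hl] := simple_generates_one hsimple q0.
  apply: R1; rewrite -(rmorph1 phi) -hl rmorph_sum big1 // => c _.
  by rewrite !rmorphM rmorphB rmorph1 phi_pu subrr mulr0 mul0r.
- move=> x; apply: (nonzero_divides_one halpha hR) => //.
  exact: left_ore.
Qed.
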